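(* Let $G$ be a finite simple graph on $n$ vertices without isolated vertices, let $k\ge 2$ be an integer, and let $\lambda_{n-1}$ be the largest eigenvalue of the normalized Laplacian matrix $\mathbf L=\mathbf I-\mathbf D^{-1/2}\mathbf A\mathbf D^{-1/2}$ of $G$. Suppose $\lambda_{n-1}=\frac{k}{k-1}$ and that $G$ admits a (proper) $k$-colouring. Then any $k$-colouring of $G$ is regular.
   Context: $\mathbf A$ is the adjacency matrix of $G$ and $\mathbf D$ is the diagonal matrix of vertex degrees. A $k$-colouring is a partition of $V(G)$ into $k$ (nonempty) independent sets, called colour classes. A colouring is regular if the number of edges between two distinct colour classes is the same for every pair of distinct colour classes. *)

(* Defs.v *)
From mathcomp Require Import all_boot all_order all_algebra.

Set Implicit Arguments.
Unset Strict Implicit.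
Unset Printing Implicit Defensive.

Import Order.TTheory GRing.Theory Num.Theory.
Local Open Scope ring_scope.

(* A finite simple graph is a symmetric irreflexive relation on a finType;
   the rows and columns of its matrices are indexed by vertices via enum_val. *)

Definition simple_graph (V : finType) (e : rel V) : Prop :=
  symmetric e /\ irreflexive e.

Definition degree (V : finType) (e : rel V) (v : V) : nat :=
  #|[set w | e v w]|.

Definition no_isolated_vertex (V : finType) (e : rel V) : Prop :=
  forall v : V, exists w : V, e v w.

Definition adjacency_mx (R : rcfType) (V : finType) (e : rel V) : 'M[R]_#|V| :=
  \matrix_(i, j) (e (enum_val i) (enum_val j))%:R.

(* D^(-1/2); if all degrees are positive, so are its diagonal entries. *)
Definition degree_invsqrt_mx (R : rcfType) (V : finType) (e : rel V) :
    'M[R]_#|V| :=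
  diag_mx (\row_i (Num.sqrt (degree e (enum_val i))%:R)^-1).

Definition normalized_laplacian (R : rcfType) (V : finType) (e : rel V) :
    'M[R]_#|V| :=
  1%:M - degree_invsqrt_mx R e *m adjacency_mx R e *m degree_invsqrt_mx R e.

Definition largest_eigenvalue (R : rcfType) (n : nat) (M : 'M[R]_n) (a : R) :
    Prop :=
  eigenvalue M a /\ forall b : R, eigenvalue M b -> b <= a.

Definition independent (V : finType) (e : rel V) (A : {set V}) : Prop :=
  forall u v : V, u \in A -> v \in A -> ~~ e u v.

(* The blocks of a [partition] are nonempty by definition. *)
Definition colouring (V : finType) (e : rel V) (k : nat)
    (P : {set {set V}}) : Prop :=
  [/\ partition P [set: V], #|P| = k
    & forall A : {set V}, A \in P -> independent e A].

(* Edges are unordered pairs of vertices. *)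
Definition edges_between (V : finType) (e : rel V) (A B : {set V}) :
    {set {set V}} :=
  [set [set u; v] | u in A, v in B & e u v].

Definition regular_colouring (V : finType) (e : rel V) (P : {set {set V}}) :
    Prop :=
  forall A B C D : {set V}, A \in P -> B \in P -> C \in P -> D \in P ->
    A != B -> C != D -> #|edges_between e A B| = #|edges_between e C D|.

(* Main.v *)
Require Import Defs.
From mathcomp Require Import all_boot all_order all_algebra.
From mathcomp Require Import complex ring lra.

Set Implicit Arguments.
Unset Strict Implicit.
Unset Printing Implicit Defensive.

Import Order.TTheory GRing.Theory Num.Theory.
Local Open Scope ring_scope.

(** Write e(A,B) for the number of edges between two classes, vol A for the sum
    of the degrees in A, and S for the sum of the volumes of all classes.  The
    largest eigenvalue bounds the Rayleigh quotient of the normalized Laplacian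
    L ([symmetric_form_le]).  Evaluated at D^(1/2) f, the quadratic form of L is
    sum_u d(u) f(u)^2 - sum_(u,v) a(u,v) f(u) f(v), with a the
    adjacency matrix, so the bound becomes an inequality about functions on the
    vertices ([adjacency_form_ge]).

    Test it on the function that is 1 on a class A, -1 on another class B and 0
    elsewhere.  As A and B are independent, only the edges between A and B
    contribute to the adjacency form, and since lambda - 1 = 1/(k-1) one gets
    that
        slack(A,B) = vol A + vol B - 2 (k-1) e(A,B)
    is nonnegative ([edge_count_le_volume]).  Every edge leaving A ends in
    exactly one class, so the e(A,B) add up to vol A when B varies
    ([sum_edge_count]); hence the sum of slack(A,B) over the k-1 classes B
    other than A is S - k vol A.  These nonnegative numbers sum to zero over
    the k classes A, so each of them vanishes, and then so does every slack.
    Thus vol A = S/k for every class, and e(A,B) = S/(k(k-1)) is the same for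
    all pairs ([edge_count_tight]). *)

(** * The Rayleigh bound over a real closed field *)

(** Each row of the diagonalizing matrix is a left eigenvector, nonzero because
    the matrix is invertible. *)
Lemma eigenvalue_spectral_diag (C : numClosedFieldType) (n : nat)
    (M : 'M[C]_n) (i : 'I_n) :
  M \is normalmx -> eigenvalue M (spectral_diag M 0 i).
Proof.
move=> /orthomx_spectralP defM.
apply/eigenvalueP; exists (row i (spectralmx M)).
  rewrite -row_mul {2}defM !mulmxA mulmxV ?spectral_unit // mul1mx.
  by apply/rowP=> j; rewrite mxE mul_diag_mx !mxE.
apply: contraTneq (spectral_unit M) => row0; apply/negP => unitP.
have := row_free_unit (spectralmx M); rewrite unitP => /row_freeP [Q PQ].
move/(congr1 (mulmx^~ Q)): row0; rewrite -row_mul PQ mul0mx.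
by move/rowP/(_ i); rewrite !mxE eqxx => /eqP; rewrite oner_eq0.
Qed.

(** The spectral theorem is applied over the algebraic closure R[i]: M becomes a
    Hermitian matrix there, unitarily diagonalizable with real diagonal entries.
    These are roots in R of the characteristic polynomial of M, hence
    eigenvalues of M over R.  In the coordinates y of x in the eigenbasis both
    forms are weighted sums of the |y_i|^2. *)
Lemma symmetric_form_le (R : rcfType) (n : nat) (M : 'M[R]_n) (lambda : R) :
    M^T = M -> (forall b : R, eigenvalue M b -> b <= lambda) ->
  forall x : 'rV[R]_n,
    (x *m M *m x^T) 0 0 <= lambda * (x *m x^T) 0 0.
Proof.
move=> symM leM x; pose toC := @real_complex_def R (Phant R).
pose Mc := map_mx toC M; pose xc := map_mx toC x.
have conj_toC a : Num.conj (toC a) = toC a.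
  by apply/CrealP/complex_realP; exists a.
have Mc_herm : Mc \is hermsymmx.
  apply: realsym_hermsym.
    apply/is_hermitianmxP.
    by rewrite expr0 scale1r map_mx_id // /Mc map_trmx symM.
  by apply/mxOverP => i j; rewrite mxE; apply/complex_realP; exists (M i j).
have Mc_normal := hermitian_normalmx Mc_herm.
have defM := orthomx_spectralP Mc_normal.
pose P := spectralmx Mc; pose sp := spectral_diag Mc.
have invP : invmx P = map_mx Num.conj P^T.
  by apply: invmx_unitary; apply: spectral_unitarymx.
have sp_le i : sp 0 i <= toC lambda.
  have /complex_realP [b sp_b] : sp 0 i \is Num.real.
    by move/mxOverP: (hermitian_spectral_diag_real Mc_herm); apply.
  rewrite sp_b lecR; apply: leM.
  have := eigenvalue_spectral_diag i Mc_normal; rewrite -/sp sp_b.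
  by rewrite !eigenvalue_root_char /Mc -map_char_poly fmorph_root.
pose y := xc *m invmx P.
have PxT : P *m xc^T = map_mx Num.conj y^T.
  rewrite /y invP trmx_mul map_mxM; congr (_ *m _).
    by rewrite map_trmx trmxK map_mxCK.
  by apply/matrixP=> i j; rewrite !mxE; exact/esym/conj_toC.
have xMx : toC ((x *m M *m x^T) 0 0) = \sum_i sp 0 i * `|y 0 i| ^+ 2.
  transitivity ((xc *m Mc *m xc^T) 0 0).
    by rewrite /xc /Mc map_trmx -!map_mxM [RHS]mxE.
  rewrite [in LHS]defM -/P -/sp !mulmxA -/y -mulmxA PxT mul_mx_diag mxE.
  by apply: eq_bigr => i _; rewrite !mxE normCK mulrAC mulrC.
have xx : toC ((x *m x^T) 0 0) = \sum_i `|y 0 i| ^+ 2.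
  transitivity ((xc *m xc^T) 0 0).
    by rewrite /xc map_trmx -!map_mxM [RHS]mxE.
  rewrite -{1}[xc](mulmxKV (spectral_unit Mc)) -/P -/y -mulmxA PxT mxE.
  by apply: eq_bigr => i _; rewrite !mxE normCK.
rewrite -lecR rmorphM.
rewrite -[leLHS]/(toC _) -[leRHS]/(toC _ * toC _) xMx xx mulr_sumr.
by apply: ler_sum => i _; rewrite ler_wpM2r ?exprn_ge0.
Qed.

(** * Adjacency form and edge counts *)

Section Graph.
Variables (R : rcfType) (V : finType) (e : rel V).

Lemma sum_enum_val (F : V -> R) :
  \sum_(i < #|V|) F (enum_val i) = \sum_v F v.
Proof. by rewrite -big_enum_val. Qed.

(** Ordered pairs are counted, so for A = B each inner edge counts twice.
    Factors 0 and 1 take the place of restricted ranges in the sums so that the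
    form of a combination of indicator functions expands by ring identities. *)
Definition edge_count (A B : {set V}) : R :=
  \sum_u \sum_v (u \in A)%:R * (v \in B)%:R * (e u v)%:R.

Lemma sum_degree (u : V) : \sum_v (e u v)%:R = (degree e u)%:R :> R.
Proof.
rewrite /degree -sum1dep_card natr_sum [RHS]big_mkcond.
by apply: eq_bigr => v _; case: (e u v).
Qed.

(** The Rayleigh bound at x = f D^(1/2): the outer factors D^(-1/2) of the
    normalized adjacency matrix turn x back into f, while x x^T carries the
    degrees as weights.  The absence of isolated vertices makes D^(1/2)
    invertible. *)
Lemma adjacency_form_ge (lambda : R) (f : V -> R) :
    symmetric e -> no_isolated_vertex e ->
    largest_eigenvalue (normalized_laplacian R e) lambda ->
  (1 - lambda) * \sum_u (degree e u)%:R * f u ^+ 2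
    <= \sum_u \sum_v f u * f v * (e u v)%:R.
Proof.
move=> sym_e hiso [_ le_lambda].
pose L := normalized_laplacian R e; pose S := degree_invsqrt_mx R e.
pose A := adjacency_mx R e.
pose r v : R := Num.sqrt (degree e v)%:R.
have r_neq0 v : r v != 0.
  rewrite sqrtr_eq0 -ltNge ltr0n; have [w evw] := hiso v.
  by apply/card_gt0P; exists w; rewrite inE.
have symA : A^T = A by apply/matrixP => i j; rewrite !mxE sym_e.
have symS : S^T = S by rewrite tr_diag_mx.
have symL : L^T = L.
  rewrite /L /normalized_laplacian linearB /= trmx1 !trmx_mul symA symS.
  by rewrite mulmxA.
pose x : 'rV[R]_#|V| := \row_i (r (enum_val i) * f (enum_val i)).
pose y : 'rV[R]_#|V| := \row_i f (enum_val i).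
have xS : x *m S = y.
  by apply/rowP=> i; rewrite mul_mx_diag !mxE mulrAC mulfV ?mul1r.
have Sx : S *m x^T = y^T by rewrite -xS trmx_mul symS.
have xx : (x *m x^T) 0 0 = \sum_u (degree e u)%:R * f u ^+ 2.
  rewrite mxE -sum_enum_val; apply: eq_bigr => i _; rewrite !mxE.
  by rewrite -expr2 exprMn sqr_sqrtr ?ler0n.
have yAy : (y *m A *m y^T) 0 0 = \sum_u \sum_v f u * f v * (e u v)%:R.
  rewrite exchange_big mxE -sum_enum_val; apply: eq_bigr => j _.
  rewrite !mxE -sum_enum_val mulr_suml; apply: eq_bigr => i _.
  by rewrite !mxE mulrAC.
have := symmetric_form_le symL le_lambda x.
have -> : x *m L *m x^T = x *m x^T - y *m A *m y^T.
  rewrite /L /normalized_laplacian mulmxBr mulmx1 mulmxBl; congr (_ - _).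
  by rewrite -/S -/A !mulmxA xS -mulmxA Sx.
rewrite mxE [X in _ + X]mxE xx yAy; lra.
Qed.

(** Disjointness makes the unordered pair {u, v} determine which of its ends
    lies in A, so each edge comes from a single ordered pair. *)
Lemma card_edges_between (A B : {set V}) : [disjoint A & B] ->
  (#|edges_between e A B|)%:R = edge_count A B.
Proof.
move=> disAB; pose E := [set p in setX A B | e p.1 p.2].
have -> : edges_between e A B = [set [set p.1; p.2] | p in E].
  apply/setP=> X; apply/imset2P/imsetP.
    case=> u v uA /[!inE] /andP[vB euv] ->; exists (u, v) => //.
    by rewrite !inE /= uA vB.
  case=> [[u v]] /[!inE] /= /andP[/andP[uA vB] euv] ->.
  by exists u v; rewrite ?inE ?vB.
rewrite card_in_imset.
  rewrite /edge_count pair_bigA /= -sum1_card natr_sum big_mkcond /=.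
  apply: eq_bigr => [[u v]] _; rewrite !inE /=.
  case: (u \in A); case: (v \in B); case: (e u v);
    by rewrite ?mulr0 ?mul0r ?mulr1.
move=> [u v] [u' v'] /[!inE] /= /andP[/andP[uA vB] _] /andP[/andP[uA' vB'] _].
move=> eqs.
have notB w : w \in A -> w \notin B by move=> wA; rewrite (disjointFr disAB wA).
have : u \in [set u'; v'] by rewrite -eqs !inE eqxx.
have : v \in [set u'; v'] by rewrite -eqs !inE eqxx orbT.
rewrite !inE => /orP[/eqP vu'|/eqP ->].
  by move: (notB _ uA'); rewrite -vu' vB.
case/orP=> /eqP uv'; first by rewrite uv'.
by move: (notB _ uA); rewrite uv' vB'.
Qed.

Definition volume (A : {set V}) : R := \sum_(u in A) (degree e u)%:R.

Lemma edge_countC (A B : {set V}) : symmetric e ->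
  edge_count A B = edge_count B A.
Proof.
move=> sym_e; rewrite /edge_count exchange_big /=.
apply: eq_bigr => u _; apply: eq_bigr => v _.
by rewrite sym_e [X in X * _]mulrC.
Qed.

Lemma edge_count_independent (A : {set V}) : independent e A ->
  edge_count A A = 0.
Proof.
move=> indA; rewrite /edge_count big1 // => u _; rewrite big1 // => v _.
case: (boolP (u \in A)) => [uA|_]; last by rewrite !mul0r.
case: (boolP (v \in A)) => [vA|_]; last by rewrite mulr0 mul0r.
by rewrite (negbTE (indA _ _ uA vA)) mulr0.
Qed.

(** The test function is the difference of the indicators of A and B: its square
    is the indicator of the union, and independence kills the two diagonal
    terms of the adjacency form. *)
Lemma edge_count_le_volume (lambda : R) (A B : {set V}) :
    symmetric e -> no_isolated_vertex e ->
    largest_eigenvalue (normalized_laplacian R e) lambda ->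
    independent e A -> independent e B -> [disjoint A & B] ->
  2 * edge_count A B <= (lambda - 1) * (volume A + volume B).
Proof.
move=> sym_e hiso lmax indA indB disAB.
pose f u : R := (u \in A)%:R - (u \in B)%:R.
have := adjacency_form_ge f sym_e hiso lmax.
have -> : \sum_u (degree e u)%:R * f u ^+ 2 = volume A + volume B.
  rewrite /volume !(big_mkcond (fun u => u \in _)) -big_split /=.
  apply: eq_bigr => u _; rewrite /f.
  case: (boolP (u \in A)) => [uA|_].
    by rewrite (disjointFr disAB uA) /=; ring.
  by case: (u \in B) => /=; ring.
have -> : \sum_u \sum_v f u * f v * (e u v)%:R =
    edge_count A A + edge_count B B - (edge_count A B + edge_count B A).
  rewrite /edge_count -!big_split -sumrB; apply: eq_bigr => u _.
  by rewrite -!big_split -sumrB; apply: eq_bigr => v _; rewrite /f /=; ring.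
rewrite !edge_count_independent // (edge_countC B A sym_e); lra.
Qed.

(** * Sums over the colour classes *)

Lemma sum_edge_count (P : {set {set V}}) (A : {set V}) :
  partition P [set: V] -> \sum_(B in P) edge_count A B = volume A.
Proof.
move=> partP; rewrite /edge_count exchange_big /= /volume [RHS]big_mkcond /=.
apply: eq_bigr => u _; rewrite exchange_big /=.
case: ifP => uA; last first.
  by rewrite big1 // => v _; rewrite big1 // => B _; rewrite !mul0r.
rewrite -sum_degree; apply: eq_bigr => v _.
rewrite -mulr_suml -mulr_sumr mul1r -[RHS]mul1r; congr (_ * _).
have vcov : v \in cover P by rewrite (cover_partition partP) inE.
have [_ trivP _] := and3P partP.
rewrite (bigD1 (pblock P v)) ?pblock_mem //= mem_pblock vcov.
rewrite big1 ?addr0 // => B /andP[BP neqB]; case: (boolP (v \in B)) => // vB.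
by rewrite (def_pblock trivP BP vB) eqxx in neqB.
Qed.

(** Summing the inequality of [edge_count_le_volume] over all pairs of distinct
    classes gives an equality, which forces equality for each pair. *)
Lemma edge_count_tight (k : nat) (P : {set {set V}}) (A B : {set V}) :
    (2 <= k)%N -> symmetric e -> no_isolated_vertex e ->
    largest_eigenvalue (normalized_laplacian R e) (k%:R / (k%:R - 1)) ->
    colouring e k P -> A \in P -> B \in P -> A != B ->
  k%:R * (k%:R - 1) * edge_count A B = \sum_(C in P) volume C.
Proof.
move=> k_ge2 sym_e hiso lmax [partP cardP indP] AP BP neqAB.
have k1_gt0 : 0 < k%:R - 1 :> R by rewrite subr_gt0 ltr1n.
set S := \sum_(C in P) volume C.
have [_ trivP _] := and3P partP.
pose slack C D := volume C + volume D - 2 * (k%:R - 1) * edge_count C D.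
have slack_ge0 C D : C \in P -> D \in P -> D != C -> 0 <= slack C D.
  move=> CP DP neqDC; have disCD : [disjoint C & D].
    by apply: (trivIsetP trivP) => //; rewrite eq_sym.
  have := edge_count_le_volume sym_e hiso lmax (indP _ CP) (indP _ DP) disCD.
  have -> : k%:R / (k%:R - 1) - 1 = (k%:R - 1)^-1 :> R.
    by field; rewrite gt_eqF.
  rewrite mulrC ler_pdivlMl // /slack; lra.
have sum_slack C :
    C \in P -> \sum_(D in P | D != C) slack C D = S - k%:R * volume C.
  move=> CP.
  (* The term D = C is included first, so that the sums run over all of P; as
     C is independent, it contributes 2 vol C. *)
  have : \sum_(D in P) slack C D =
      k%:R * volume C + S - 2 * (k%:R - 1) * volume C.
    rewrite sumrB big_split /= sumr_const cardP -mulr_sumr sum_edge_count //.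
    by rewrite -[volume C *+ k]mulr_natl.
  rewrite (bigD1 C) //= {1}/slack (edge_count_independent (indP _ CP)); lra.
have S_eq C : C \in P -> k%:R * volume C = S.
  move=> CP; apply/eqP; rewrite eq_sym -subr_eq0; apply/eqP.
  apply: (psumr_eq0P (P := mem P) (F := fun C => S - k%:R * volume C)) CP.
    move=> D DP; rewrite -sum_slack //; apply: sumr_ge0 => E /andP[EP neqED].
    exact: slack_ge0.
  by rewrite sumrB sumr_const cardP -mulr_sumr mulr_natl subrr.
have : slack A B = 0.
  apply: (psumr_eq0P (P := fun D => (D \in P) && (D != A)) (F := slack A)).
  - by move=> D /andP[DP neqDA]; apply: slack_ge0.
  - by rewrite sum_slack // S_eq ?subrr.
  - by rewrite BP eq_sym.
move/(congr1 ( *%R k%:R)); rewrite /slack mulrBr mulrDr !S_eq // mulr0; lra.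
Qed.

End Graph.

Theorem theorem13 (R : rcfType) (V : finType) (e : rel V)
    (hG : simple_graph e) (hiso : no_isolated_vertex e)
    (k : nat) (hk : (2 <= k)%N)
    (lambda : R)
    (hmax : largest_eigenvalue (normalized_laplacian R e) lambda)
    (hlambda : lambda = k%:R / (k%:R - 1))
    (hcol : exists P : {set {set V}}, colouring e k P) :
  forall P : {set {set V}}, colouring e k P -> regular_colouring e P.
Proof.
move=> P colP A B C D AP BP CP DP neqAB neqCD; rewrite hlambda in hmax.
have [partP _ _] := colP; have [_ /trivIsetP trivP _] := and3P partP.
have k_neq0 : k%:R * (k%:R - 1) != 0 :> R.
  by rewrite mulf_neq0 ?subr_eq0 ?pnatr_eq1 ?pnatr_eq0 ?gtn_eqF // ltnW.
apply/eqP; rewrite -(eqr_nat R) !card_edges_between ?trivP //; apply/eqP.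
by apply: (mulfI k_neq0); rewrite !(edge_count_tight hk hG.1 hiso hmax colP).
Qed.
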